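(* Let $D$ be a dissimilarity matrix of embedding dimension $(p,q)$. Then there exist $r>0$ and a set of points in the sphere $S_{p,q}(r)$ whose indefinite-distance matrix is $D$ if and only if $D$ is of Type (2).
   Context: $\mathbb{R}^{p,q}$ is $\mathbb{R}^{p+q}$ with the bilinear form $\langle\langle x,y\rangle\rangle=x_1y_1+\cdots+x_py_p-x_{p+1}y_{p+1}-\cdots-x_{p+q}y_{p+q}$, and $\|x\|:=\langle\langle x,x\rangle\rangle$. For $r>0$, $S_{p,q}(r)=\{x\in\mathbb{R}^{p,q} : \langle\langle x,x\rangle\rangle=r\}$. A dissimilarity matrix on a finite set $V$ with $|V|=n$ is a matrix $D=\sum_{i=1}^s a_iA_i$ with $a_i\in\mathbb{R}$, where $A_1,\ldots,A_s$ are the symmetric $(0,1)$-matrices of nonempty symmetric relations $R_1,\ldots,R_s$ which together with $R_0=\{(u,u):u\in V\}$ partition $V\times V$; thus $D$ is a real symmetric matrix with zero diagonal. The indefinite-distance matrix of a family of points $(x_v)_{v\in V}$ in $\mathbb{R}^{p,q}$ is $(\|x_u-x_v\|)_{u,v\in V}$ (points with different indices are allowed to coincide). The signature of a real symmetric matrix is (number of positive eigenvalues, number of negative eigenvalues), with multiplicity. Let $j$ be the all-one vector and $I$ the identity matrix. For $\ell\in\mathbb{R}^n$ with $\ell^\top j=1$ put $F_D(\ell)=-(I-j\ell^\top)D(I-\ell j^\top)$; its signature does not depend on $\ell$ (Gower). The embedding dimension of $D$ is $(p,q)$ := the signature of $F_D(\ell)$. For an eigenvalue $\tau$ of $D$ with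 orthogonal projection matrix $E$ onto its eigenspace, the main angle is $\beta=\frac{1}{\sqrt n}\sqrt{(Ej)^\top(Ej)}$; $\tau$ is main if $\beta\ne0$. $D$ is of Type (2) if the kernel of $D$ is contained in $j^\perp$ (i.e. $0$ is not a main eigenvalue of $D$) and $\sum_i\beta_i^2/\lambda_i>0$, where $\lambda_i$ runs over the distinct main eigenvalues of $D$ and $\beta_i$ is the main angle of $\lambda_i$. Equivalently, the signature of $-D$ is $(p,q+1)$. *)

(* Defs.v *)
From mathcomp Require Import all_boot all_order all_algebra.
From mathcomp Require Import reals.
From mathcomp Require Import polyrcf.

Set Implicit Arguments.
Unset Strict Implicit.
Unset Printing Implicit Defensive.

Import Order.TTheory GRing.Theory Num.Theory.
Local Open Scope ring_scope.

Section PseudoEuclidean.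
Variables (R : realType) (p q : nat).

(* The ambient space R^{p,q} is 'cV[R]_(p + q): the first p coordinates
   (lshift) are positive, the last q (rshift) negative. *)
Definition bform (x y : 'cV[R]_(p + q)) : R :=
  \sum_(i < p) x (lshift q i) 0 * y (lshift q i) 0
  - \sum_(i < q) x (rshift p i) 0 * y (rshift p i) 0.

(* There is deliberately no square root: this "norm" can be negative. *)
Definition inorm (x : 'cV[R]_(p + q)) : R := bform x x.

Definition sphere (r : R) : {pred 'cV[R]_(p + q)} := fun x => bform x x == r.

Definition idist_mx (n : nat) (x : 'I_n -> 'cV[R]_(p + q)) : 'M[R]_n :=
  \matrix_(u, v) inorm (x u - x v).

End PseudoEuclidean.

Section Dissimilarity.
Variables (R : realType) (n : nat).
Implicit Types (A D : 'M[R]_n) (l : 'cV[R]_n) (t : R).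

Definition rel_mx (T : {set 'I_n * 'I_n}) : 'M[R]_n :=
  \matrix_(u, v) ((u, v) \in T)%:R.

(* The family S is indexed by 0, ..., s, with S 0 the diagonal; partition
   includes the nonemptiness of every block, and injectivity makes blocks with
   different indices disjoint. The coefficients a are arbitrary reals. *)
Definition dissimilarity D : Prop :=
  exists (s : nat) (S : 'I_s.+1 -> {set 'I_n * 'I_n}) (a : 'I_s -> R),
    [/\ S ord0 = [set uv | uv.1 == uv.2],
        injective S,
        partition [set S i | i : 'I_s.+1] [set: 'I_n * 'I_n],
        forall i u v, ((u, v) \in S i) = ((v, u) \in S i)
      & D = \sum_(i < s) a i *: rel_mx (S (lift ord0 i))].

(* The distinct (real) eigenvalues. *)
Definition spectrum A : seq R := rootsR (char_poly A).

Definition signature A : nat * nat :=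
  (\sum_(t <- spectrum A | (0 < t)%R) mup t (char_poly A),
   \sum_(t <- spectrum A | (t < 0)%R) mup t (char_poly A))%N.

Definition allone : 'cV[R]_n := const_mx 1.

Definition gower_mx D l : 'M[R]_n :=
  - ((1%:M - allone *m l^T) *m D *m (1%:M - l *m allone^T)).

(* For symmetric D the signature of gower_mx D l is the same for all l with
   l^T j = 1 (Gower), so "exists l" here amounts to "forall l" when n > 0;
   the existence of l also rules out n = 0. *)
Definition embedding_dim D (p q : nat) : Prop :=
  exists l, l^T *m allone = 1%:M /\ signature (gower_mx D l) = (p, q).

(* eigenspace D t is the row space of left eigenvectors, and kermx U^T is the
   orthogonal complement of the row space of U. For symmetric D left and right
   eigenvectors coincide; moreover this matrix is symmetric
   (eigenproj_sym below), so that it acts in the same way on rows and on columns. *)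
Definition eigenproj D t : 'M[R]_n :=
  proj_mx (eigenspace D t) (kermx (eigenspace D t)^T).

Definition main_angle D t : R :=
  (Num.sqrt n%:R)^-1 *
  Num.sqrt (((eigenproj D t *m allone)^T *m (eigenproj D t *m allone)) 0 0).

Definition main_spectrum D : seq R :=
  [seq t <- spectrum D | main_angle D t != 0].

Definition type2 D : Prop :=
  (forall x : 'cV[R]_n, D *m x = 0 -> allone^T *m x = 0) /\
  0 < \sum_(t <- main_spectrum D) main_angle D t ^+ 2 / t.

Lemma mem_spectrum A t : (t \in spectrum A) = eigenvalue A t.
Proof.
have p0 : char_poly A != 0 by rewrite monic_neq0 ?char_poly_monic.
by rewrite eigenvalue_root_char /spectrum -roots_on_rootsR.
Qed.

Lemma spectrum_uniq A : uniq (spectrum A).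
Proof. exact: uniq_roots. Qed.

Section OrthogonalComplement.
Variables (m : nat) (U : 'M[R]_(m, n)).

Lemma cap_ortho : (U :&: kermx U^T = 0)%MS.
Proof.
apply/eqP/rowV0P => w; rewrite sub_capmx => /andP[/submxP[a wE]] /sub_kermxP h.
have /eqP : (w *m w^T) 0 0 = 0 by rewrite {2}wE trmx_mul mulmxA h mul0mx mxE.
rewrite mxE psumr_eq0 => [|i _]; last by rewrite mxE -expr2 sqr_ge0.
move=> /allP w0; apply/rowP => i; rewrite mxE.
have := w0 i (mem_index_enum _); rewrite /= mxE mulf_eq0 orbb.
by move=> /eqP.
Qed.

Lemma add_ortho : row_full (U + kermx U^T)%MS.
Proof.
have := mxrank_sum_cap U (kermx U^T).
rewrite cap_ortho mxrank0 addn0 mxrank_ker mxrank_tr /row_full => ->.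
by rewrite subnKC // rank_leq_col.
Qed.

End OrthogonalComplement.

Lemma eigenproj_sym D t : (eigenproj D t)^T = eigenproj D t.
Proof.
rewrite /eigenproj; set U := eigenspace D t; set E := proj_mx _ _.
have /submxP[X EX] : (E <= U)%MS by rewrite -[E]mul1mx proj_mx_sub.
have : (1%:M - 1%:M *m E <= kermx U^T)%MS.
  by apply: proj_mx_compl_sub; rewrite sub1mx add_ortho.
move=> /sub_kermxP h; clearbody E.
have : (1%:M - E) *m E^T = 0.
  by rewrite {2}EX trmx_mul mulmxA -{1}[E]mul1mx h mul0mx.
move/eqP; rewrite mulmxBl mul1mx subr_eq0 => /eqP ET.
have EE : E = E *m E^T by apply: trmx_inj; rewrite trmx_mul trmxK.
by rewrite ET -EE.
Qed.

End Dissimilarity.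

(* Main.v *)
Require Import Defs.
From mathcomp Require Import all_boot all_order all_algebra.
From mathcomp Require Import reals.
From mathcomp Require Import complex ring.

(** The proof rests on two reformulations which remove eigenvalues from both
sides of the equivalence; j is the all-one vector and E = diag(I_p, -I_q) the
matrix of the form.

Write D = P^T diag(d) P with P orthogonal ([sym_spectral]) and c = P j. The sum
of the beta^2 / lambda is then (1/n) sum_i c_i^2 / d_i, and the condition on
the kernel says that c_i = 0 whenever d_i = 0, i.e. that j is in the range of D.
So D is of Type (2) exactly when D w = j for some w with j^T w > 0 ([type2P]).
On the other side, the spectral theorem factors a symmetric matrix of signature
(p, q) as Z^T E Z, with Z of full rank p + q ([signature_factor]); applied to
the Gower matrix, this gives the coordinates of the points.

If points of S_{p,q}(r), the columns of X, realize D, then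
D = 2r j j^T - 2 X^T E X ([sphere_idist_mx]). The Gower matrix at l is then
2 Y^T E Y with Y = X (I - l j^T), and it has rank p + q, so already the vectors
of j^perp are mapped by X onto the whole space. In particular X l = X u for some
u in j^perp. The vector l - u is killed by X and has coordinate sum 1, whence
D (l - u) = 2r j, and w = (l - u) / 2r is as required.

Conversely let D w = j and j^T w = c > 0. At l' = w / c the Gower matrix is
j j^T / c - D. Its diagonal is constant because that of D vanishes, and its half is, by recentring
([gower_mx_recenter]) the factorization at l, the Gram matrix X^T E X of some
points. They lie on the sphere with r = 1 / (2c), and their distance matrix
2r j j^T - 2 X^T E X is D. *)

Set Implicit Arguments.
Unset Strict Implicit.
Unset Printing Implicit Defensive.

Import Order.TTheory GRing.Theory Num.Theory.
Local Open Scope ring_scope.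

(** * The spectral theorem for real symmetric matrices *)

Section RealSpectralTheorem.
Variable R : rcfType.

(** Over the complex numbers the matrix is Hermitian, so its eigenvalues are
real, hence roots of its real characteristic polynomial. *)
Lemma sym_eigenvalue n (A : 'M[R]_n.+1) : A^T = A -> exists t, eigenvalue A t.
Proof.
move=> symA; pose C := R[i]%C; pose B : 'M[C]_n.+1 := map_mx (real_complex R) A.
have hermB : B \is hermsymmx.
  apply/is_hermitianmxP; rewrite expr0 scale1r; apply/matrixP => i j.
  by rewrite !mxE -{1}symA mxE; apply/esym/CrealP/complex_realP; exists (A j i).
have /complex_realP[t dE] :=
  mxOverP (hermitian_spectral_diag_real hermB) ord0 (ord0 : 'I_n.+1).
exists t; have /hermitian_normalmx/orthomx_spectralP BE := hermB.
have: eigenvalue B t%:C%C.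
  apply/eigenvalueP; exists (row 0 (spectralmx B)).
    rewrite {2}BE -!row_mul !mulmxA mulmxV ?spectral_unit// mul1mx.
    by rewrite row_mul row_diag_mx dE -scalemxAl -rowE.
  have: row_free (spectralmx B) by rewrite row_free_unit spectral_unit.
  move=> /row_freeP[Q PQ]; apply/eqP => r0.
  have := congr1 (row 0) PQ; rewrite row_mul r0 mul0mx => /rowP/(_ 0).
  by rewrite !mxE eqxx => /esym/eqP; rewrite oner_eq0.
by rewrite !eigenvalue_root_char -map_char_poly fmorph_root.
Qed.

Lemma dotmx_gt0 n (u : 'rV[R]_n) : u != 0 -> 0 < (u *m u^T) 0 0.
Proof.
move=> u0; rewrite lt_def; apply/andP; split; last first.
  by rewrite mxE sumr_ge0// => i _; rewrite mxE -expr2 sqr_ge0.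
apply: contraNneq u0; rewrite mxE => /eqP; rewrite psumr_eq0 => [|i _].
  move=> /allP h; apply/eqP/rowP => i; rewrite mxE.
  by have := h i (mem_index_enum _); rewrite /= mxE mulf_eq0 orbb => /eqP.
by rewrite mxE -expr2 sqr_ge0.
Qed.

(** The witness is the Householder reflection in the hyperplane orthogonal to
v - e. *)
Lemma orthogonal_row n (e v : 'rV[R]_n) : e *m e^T = 1%:M -> v *m v^T = 1%:M ->
  exists H : 'M_n, [/\ H^T = H, H *m H = 1%:M & e *m H = v].
Proof.
move=> ee vv; have [<-|nev] := eqVneq e v.
  by exists 1%:M; rewrite trmx1 !mulmx1.
have u0 : v - e != 0 by rewrite subr_eq0 eq_sym.
have := dotmx_gt0 u0; set u := v - e; set c := (u *m u^T) 0 0 => c0.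
have uu : u *m u^T = c%:M by rewrite [LHS]mx11_scalar.
pose a := (e *m v^T) 0 0.
have ev : e *m v^T = a%:M by rewrite [LHS]mx11_scalar.
have ve : v *m e^T = a%:M by apply: trmx_inj; rewrite trmx_mul trmxK tr_scalar_mx.
have eu : e *m u^T = (a - 1)%:M by rewrite raddfB mulmxBr ev ee -raddfB.
have cE : c = - 2 * (a - 1).
  have := uu; rewrite {1}/u mulmxBl eu /u raddfB mulmxBr vv ve -!raddfB /=.
  move/(congr1 (fun M : 'M_1 => M 0 0)); rewrite !mxE eqxx !mulr1n => <-.
  by ring.
have vE : v = e + u by rewrite /u addrC subrK.
move: c0 uu cE; rewrite vE -/u; clearbody u c => c0 uu cE.
exists (1%:M - (2 / c) *: (u^T *m u)); split.
- by rewrite raddfB /= trmx1 linearZ /= trmx_mul trmxK.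
- have WW : u^T *m u *m (u^T *m u) = c *: (u^T *m u).
    by rewrite mulmxA -[u^T *m u *m u^T]mulmxA uu mul_mx_scalar scalemxAl.
  rewrite mulmxBl mul1mx mulmxBr mulmx1 -scalemxAl -scalemxAr WW !scalerA.
  rewrite -addrA -opprD -scalerBl -scalerDl.
  by rewrite [X in X *: _](_ : _ = 0) ?scale0r ?subr0//; field; rewrite gt_eqF.
- rewrite mulmxBr mulmx1 -scalemxAr mulmxA eu mul_scalar_mx scalerA -scaleNr.
  rewrite [X in X *: _](_ : _ = 1) ?scale1r//.
  by rewrite -mulNr -mulNr mulrAC -cE divff ?gt_eqF.
Qed.

(** By induction on the size: a reflection carrying the first basis vector to a
unit eigenvector splits off a 1 x 1 diagonal block, and symmetry clears the rest
of the first column. *)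
Lemma sym_spectral n (A : 'M[R]_n) : A^T = A ->
  exists (P : 'M[R]_n) (d : 'rV[R]_n),
    P *m P^T = 1%:M /\ A = P^T *m diag_mx d *m P.
Proof.
elim: n A => [|n IH] A symA.
  by exists 1%:M, 0; split; [rewrite trmx1 mulmx1 | apply/matrixP => -[]].
have [t /eigenvalueP[v0 v0A v0n]] := sym_eigenvalue symA.
have [v vA vv] : exists2 v : 'rV_n.+1, v *m A = t *: v & v *m v^T = 1%:M.
  have := dotmx_gt0 v0n; set c := (_ *m _) 0 0 => c0.
  exists ((Num.sqrt c)^-1 *: v0); first by rewrite -scalemxAl v0A !scalerA mulrC.
  rewrite -scalemxAl linearZ -scalemxAr scalerA /= [v0 *m _]mx11_scalar -/c.
  by rewrite scale_scalar_mx -expr2 exprVn sqr_sqrtr ?(ltW c0)// mulVf ?gt_eqF.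
pose e : 'rV[R]_(1 + n) := row_mx 1%:M 0.
have ee : e *m e^T = 1%:M.
  by rewrite tr_row_mx mul_row_col trmx1 mulmx1 trmx0 mulmx0 addr0.
have [H [symH HH eH]] := orthogonal_row ee vv.
pose B : 'M[R]_(1 + n) := H *m A *m H.
have symB : B^T = B by rewrite !trmx_mul symA symH mulmxA.
have eB : e *m B = t *: e.
  by rewrite !mulmxA eH vA -scalemxAl -eH -mulmxA HH mulmx1.
have BE : B = block_mx t%:M 0 0 (drsubmx B).
  have: usubmx B = row_mx t%:M 0.
    by move: eB; rewrite -{1}[B]vsubmxK mul_row_col mul1mx mul0mx addr0 => ->;
       rewrite scale_row_mx scaler0 scale_scalar_mx mulr1.
  move=> uB; rewrite -{1}[B]submxK /ulsubmx /ursubmx uB row_mxKl row_mxKr.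
  congr block_mx; rewrite -[B]symB.
  by rewrite -[LHS]trmxK trmx_dlsub trmxK /ursubmx uB row_mxKr trmx0.
have symB' : (drsubmx B)^T = drsubmx B by rewrite trmx_drsub symB.
have [P' [d' [PP' B'E]]] := IH _ symB'.
pose Q : 'M_(1 + n) := block_mx 1%:M 0 0 P'.
exists (Q *m H), (row_mx t%:M d'); split.
  have QQ : Q *m Q^T = 1%:M.
    rewrite /Q tr_block_mx mulmx_block !trmx0 trmx1 !mul0mx !mulmx0 mulmx1 PP'.
    by rewrite !addr0 add0r -scalar_mx_block.
  by rewrite trmx_mul symH mulmxA -[Q *m H *m H]mulmxA HH mulmx1.
have: B = Q^T *m diag_mx (row_mx t%:M d') *m Q.
  rewrite diag_mx_row /Q tr_block_mx !mulmx_block !trmx0 trmx1.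
  rewrite !mul0mx !mulmx0 !(mul1mx, mulmx1, addr0, add0r, mul0mx, mulmx0).
  rewrite {1}BE {1}B'E; congr block_mx.
  by apply/matrixP => i j; rewrite !ord1 !mxE eqxx.
move=> /(congr1 (fun M => H *m M *m H)); rewrite trmx_mul symH !mulmxA.
by rewrite HH mul1mx -[A *m H *m H]mulmxA HH mulmx1.
Qed.

End RealSpectralTheorem.

(** * The signature read off a spectral decomposition *)

Section Signature.
Variable R : realType.

Lemma char_poly_spectral n (P : 'M[R]_n) (d : 'rV[R]_n) : P *m P^T = 1%:M ->
  char_poly (P^T *m diag_mx d *m P) = \prod_i ('X - (d 0 i)%:P).
Proof.
move=> PP; have PTP := mulmx1C PP.
have: char_poly (diag_mx d) = \prod_i ('X - (d 0 i)%:P).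
  rewrite char_poly_trig ?diag_mx_is_trig//; apply: eq_bigr => i _.
  by rewrite mxE eqxx.
move=> <-; rewrite /char_poly /char_poly_mx !map_mxM.
have PTPp : map_mx polyC P^T *m map_mx polyC P = 1%:M.
  by rewrite -map_mxM PTP map_mx1.
rewrite -[X in \det (X - _)]mulmx1 -{1}PTPp mulmxA -scalar_mxC -mulmxBl -mulmxBr.
by rewrite !det_mulmx mulrAC -det_mulmx PTPp det1 mul1r.
Qed.

(** The multiplicity of t as a root of the characteristic polynomial is the
number of indices i with d_i = t. *)
Lemma sum_mup_spectrum n (P : 'M[R]_n) (d : 'rV[R]_n) (Q : pred R) :
  P *m P^T = 1%:M ->
  (\sum_(t <- spectrum (P^T *m diag_mx d *m P) | Q t)
     mup t (char_poly (P^T *m diag_mx d *m P)))%N = #|[pred i | Q (d 0 i)]|.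
Proof.
move=> PP; set A := _ *m P; have chA : char_poly A = _ := char_poly_spectral d PP.
pose ds := [seq d 0 i | i <- index_enum 'I_n].
have chE : char_poly A = \prod_(x <- ds) ('X - x%:P) by rewrite chA big_map.
under eq_bigr => t _ do rewrite chE mu_prod_XsubC /ds count_map -sum1_count.
rewrite (exchange_big_dep predT) //= -sum1_card.
rewrite [RHS]big_mkcond; apply: eq_bigr => i _ /=.
rewrite sum1_count.
have -> : count (fun t => Q t && (d 0 i == t)) (spectrum A)
        = count_mem (d 0 i) (filter Q (spectrum A)).
  by rewrite count_filter; apply: eq_count => t /=; rewrite andbC eq_sym.
rewrite count_uniq_mem ?filter_uniq ?spectrum_uniq// mem_filter.
rewrite mem_spectrum eigenvalue_root_char chE root_prod_XsubC.
by rewrite map_f ?mem_index_enum// andbT inE; case: (Q _).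
Qed.

(** The rows of X are the eigenvectors of nonzero eigenvalue d_i, scaled by
sqrt |d_i|, those with d_i > 0 coming first; they are orthogonal, hence X has
full rank. *)
Lemma signature_factor n p q (A : 'M[R]_n) : A^T = A -> signature A = (p, q) ->
  exists2 X : 'M[R]_(p + q, n), row_free X &
    A = X^T *m block_mx 1%:M 0 0 (- 1%:M) *m X.
Proof.
move=> symA; have [P [d [PP ->]]] := sym_spectral symA.
rewrite /signature !sum_mup_spectrum// => -[<- <-] {p q symA A}.
set pos := [pred i | 0 < d 0 i]; set neg := [pred i | d 0 i < 0].
(* Positive eigenvalues are listed first, to match the signs of the form. *)
pose f (k : 'I_(#|pos| + #|neg|)) : 'I_n :=
  match split k with inl k => enum_val k | inr k => enum_val k end.
have fl k : f (lshift _ k) = enum_val k by rewrite /f (unsplitK (inl _ k)).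
have fr k : f (rshift _ k) = enum_val k by rewrite /f (unsplitK (inr _ k)).
have posP (k : 'I_#|pos|) : 0 < d 0 (enum_val k) by have := enum_valP k.
have negP (k : 'I_#|neg|) : d 0 (enum_val k) < 0 by have := enum_valP k.
have f_inj : injective f.
  move=> i j; case: (split_ordP i) => {}i ->; case: (split_ordP j) => {}j ->;
  rewrite ?fl ?fr => eq_ij.
  - by rewrite (enum_val_inj eq_ij).
  - by have := posP i; rewrite eq_ij ltNge ltW.
  - by have := posP j; rewrite -eq_ij ltNge ltW.
  - by rewrite (enum_val_inj eq_ij).
have f_neq0 k : d 0 (f k) != 0.
  by case: (split_ordP k) => {}k ->; [rewrite fl gt_eqF | rewrite fr lt_eqF].
pose s : 'rV[R]_(#|pos| + #|neg|) := \row_k Num.sqrt `|d 0 (f k)|.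
exists (diag_mx s *m rowsub f P).
  apply/row_freeP; exists (P^T *m colsub f 1%:M *m diag_mx (\row_k (s 0 k)^-1)).
  rewrite !mulmxA -[_ *m rowsub f P *m P^T]mulmxA mul_rowsub_mx PP.
  rewrite -[_ *m rowsub f _ *m _]mulmxA.
  have -> : rowsub f 1%:M *m colsub f 1%:M = 1%:M :> 'M[R]_(#|pos| + #|neg|).
    rewrite mulmx_colsub mulmx1; apply/matrixP => i j.
    by rewrite !mxE (inj_eq f_inj).
  rewrite mulmx1 mulmx_diag; apply/matrixP => i j; rewrite !mxE.
  by rewrite divff// sqrtr_eq0 -ltNge normr_gt0.
apply/matrixP => u v.
have -> : ((P^T *m diag_mx d) *m P) u v = \sum_i d 0 i * (P i u * P i v).
  by rewrite mxE; apply: eq_bigr => i _; rewrite mul_mx_diag !mxE; ring.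
pose eps : 'rV[R]_(#|pos| + #|neg|) := row_mx (const_mx 1) (const_mx (- 1)).
have -> : block_mx 1%:M 0 0 (- 1%:M) = diag_mx eps.
  by rewrite /eps diag_mx_row !diag_const_mx raddfN.
rewrite trmx_mul tr_diag_mx.
have -> : ((rowsub f P)^T *m diag_mx s *m diag_mx eps
             *m (diag_mx s *m rowsub f P)) u v
  = \sum_k d 0 (f k) * (P (f k) u * P (f k) v).
  rewrite mulmxA -[_ *m diag_mx s *m diag_mx eps]mulmxA -mulmxA mulmx_diag.
  rewrite mulmxA -[_ *m diag_mx _ *m diag_mx s]mulmxA mulmx_diag mxE.
  apply: eq_bigr => k _.
  have dE : d 0 (f k) = Num.sqrt `|d 0 (f k)| ^+ 2 * eps 0 k.
    rewrite sqr_sqrtr//; case: (split_ordP k) => {}k ->.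
      by rewrite row_mxEl mxE fl mulr1 gtr0_norm.
    by rewrite row_mxEr mxE fr mulrN1 ltr0_norm// opprK.
  by rewrite [in RHS]dE mul_mx_diag !mxE; ring.
rewrite big_split_ord /=.
under [X in _ = X + _]eq_bigr => k _ do rewrite fl.
under [X in _ = _ + X]eq_bigr => k _ do rewrite fr.
pose F i := d 0 i * (P i u * P i v).
rewrite -(big_enum_val (A:=pos) F) -(big_enum_val (A:=neg) F).
rewrite (bigID pos); congr (_ + _).
rewrite [RHS]big_mkcond [LHS]big_mkcond; apply: eq_bigr => i _; rewrite !inE.
by case: ltgtP => // <-; rewrite mul0r.
Qed.

End Signature.

(** * Main angles and Type (2) *)

Section Type2.
Variable R : realType.

(** The right-hand side maps into the eigenspace and fixes it, and being
symmetric it kills the orthogonal complement. *)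
Lemma eigenproj_spectral n (P : 'M[R]_n) (d : 'rV[R]_n) t : P *m P^T = 1%:M ->
  eigenproj (P^T *m diag_mx d *m P) t
  = P^T *m diag_mx (\row_i (d 0 i == t)%:R) *m P.
Proof.
move=> PP; have PTP := mulmx1C PP; set D := _ *m P; set E := RHS.
rewrite /eigenproj; set U := eigenspace D t.
have symE : E^T = E by rewrite /E !trmx_mul tr_diag_mx trmxK mulmxA.
have EU : (E <= U)%MS.
  apply/eigenspaceP; rewrite /E /D !mulmxA.
  rewrite -[_ *m P *m P^T]mulmxA PP mulmx1 -[_ *m diag_mx _ *m diag_mx d]mulmxA.
  rewrite mulmx_diag scalemxAl scalemxAr -linearZ /=; congr (_ *m diag_mx _ *m _).
  apply/rowP => i; rewrite !mxE.
  by case: eqP => [->|_]; rewrite ?mulr1 ?mul1r ?mulr0 ?mul0r.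
have UE : U *m E = U.
  have UD : U *m D = t *: U by apply/eigenspaceP.
  have : U *m P^T *m diag_mx d = t *: (U *m P^T).
    by rewrite -[U *m P^T *m _]mulmx1 -PP scalemxAl -UD /D !mulmxA.
  move=> UPd; rewrite /E !mulmxA -[RHS]mulmx1 -PTP [RHS]mulmxA.
  move: UPd; move: (U *m P^T) => M UPd; congr (_ *m _).
  apply/matrixP => i k; rewrite mul_mx_diag !mxE.
  have /matrixP/(_ i k) := UPd; rewrite mul_mx_diag !mxE => /eqP.
  case: (eqVneq (d 0 k) t) => [_ _|dk]; first by rewrite mulr1.
  rewrite mulrC -subr_eq0 -mulrBl mulf_eq0 subr_eq0 (negPf dk) /= => /eqP ->.
  by rewrite mul0r.
have EK : (1%:M - E <= kermx U^T)%MS.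
  apply/sub_kermxP; apply: trmx_inj; rewrite trmx_mul trmxK raddfB /= trmx1 symE.
  by rewrite mulmxBr mulmx1 UE subrr trmx0.
have cap0 := cap_ortho U.
rewrite -[LHS]mul1mx -[1%:M](subrK E) addrC mulmxDl.
by rewrite (proj_mx_id cap0 EU) (proj_mx_0 cap0 EK) addr0.
Qed.

Lemma main_angle_spectral n (P : 'M[R]_n) (d : 'rV[R]_n) t : P *m P^T = 1%:M ->
  main_angle (P^T *m diag_mx d *m P) t ^+ 2
  = n%:R^-1 * \sum_i (d 0 i == t)%:R * (P *m allone R n) i 0 ^+ 2.
Proof.
move=> PP; rewrite /main_angle exprMn exprVn sqr_sqrtr ?ler0n//.
rewrite eigenproj_spectral// sqr_sqrtr; last first.
  by rewrite mxE sumr_ge0// => i _; rewrite mxE -expr2 sqr_ge0.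
congr (_ * _); rewrite !trmx_mul tr_diag_mx trmxK !mulmxA.
rewrite -[_ *m P *m P^T]mulmxA PP mulmx1 -[_ *m diag_mx _ *m diag_mx _]mulmxA.
rewrite mulmx_diag -mulmxA -trmx_mul mxE; apply: eq_bigr => i _.
rewrite mul_mx_diag ![in LHS]mxE.
by case: eqP => _; rewrite ?mulr0 ?mul0r ?mulr1 ?mul1r // expr2 !mxE.
Qed.

(** Non-main eigenvalues contribute nothing. An index with d_i = 0 contributes
nothing to either side, since 0^-1 = 0. *)
Lemma sum_main_angle n (P : 'M[R]_n) (d : 'rV[R]_n) (D := P^T *m diag_mx d *m P) :
  P *m P^T = 1%:M ->
  \sum_(t <- main_spectrum D) main_angle D t ^+ 2 / t
  = n%:R^-1 * \sum_i (P *m allone R n) i 0 ^+ 2 / d 0 i.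
Proof.
move=> PP; rewrite big_filter big_mkcond /=.
under eq_bigr => t _.
  have -> : (if main_angle D t != 0 then main_angle D t ^+ 2 / t else 0)
     = n%:R^-1 * \sum_i (d 0 i == t)%:R * ((P *m allone R n) i 0 ^+ 2 / d 0 i).
    transitivity (main_angle D t ^+ 2 / t).
      by case: eqP => // ->; rewrite expr0n mul0r.
    rewrite main_angle_spectral// -mulrA mulr_suml; congr (_ * _).
    by apply: eq_bigr => i _; case: eqP => [->|]; rewrite ?mul0r // !mul1r.
  over.
rewrite -mulr_sumr exchange_big /=; congr (_ * _); apply: eq_bigr => i _.
rewrite -mulr_suml (bigD1_seq (d 0 i)) ?spectrum_uniq//=.
  rewrite eqxx big1 ?addr0 ?mul1r// => t; rewrite eq_sym => /negPf -> //.
rewrite mem_spectrum eigenvalue_root_char char_poly_spectral//.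
by rewrite (bigD1 i) //= rootM root_XsubC eqxx.
Qed.

(** With w in hand, the sum over the main eigenvalues is w^T D w / n, which is
j^T w / n; conversely w is obtained by applying the pseudo-inverse of D to j. *)
Lemma type2P n (D : 'M[R]_n) : (0 < n)%N -> D^T = D ->
  type2 D <-> exists w, D *m w = allone R n /\ 0 < ((allone R n)^T *m w) 0 0.
Proof.
move=> n0 symD; have [P [d [PP DE]]] := sym_spectral symD.
have PTP := mulmx1C PP.
have n1 : 0 < n%:R^-1 :> R by rewrite invr_gt0 ltr0n.
have [c cj] : exists c, P *m allone R n = c by exists (P *m allone R n).
have := sum_main_angle d PP; rewrite -DE cj => sumE.
rewrite /type2 sumE pmulr_rgt0//; split=> [[kerD sum_gt0]|[w [Dw jw]]].
  have c0 i : d 0 i = 0 -> c i 0 = 0.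
    move=> di; pose x := P^T *m (delta_mx i 0 : 'cV[R]_n).
    (* x is the i-th eigenvector, here in the kernel of D. *)
    have : D *m x = 0.
      rewrite DE !mulmxA -[_ *m P *m P^T]mulmxA PP mulmx1 -mulmxA.
      rewrite [X in _ *m X](_ : _ = 0) ?mulmx0//.
      apply/matrixP => k l; rewrite mul_diag_mx !mxE.
      by case: (eqVneq k i) => [->|_]; rewrite ?di ?mul0r ?mulr0.
    move/kerD; rewrite mulmxA -trmx_mul cj -colE => /matrixP/(_ 0 0).
    by rewrite !mxE.
  exists (P^T *m (diag_mx (\row_i (d 0 i)^-1) *m c)); split.
    rewrite DE !mulmxA -[_ *m P *m P^T]mulmxA PP mulmx1.
    rewrite -[RHS]mul1mx -PTP -[RHS]mulmxA cj -!mulmxA; congr (_ *m _).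
    rewrite mulmxA mulmx_diag; apply/matrixP => i l; rewrite mul_diag_mx !mxE ord1.
    have [/c0 ->|di] := eqVneq (d 0 i) 0; first by rewrite mulr0.
    by rewrite divff// mul1r.
  rewrite mulmxA -trmx_mul cj mxE; congr (0 < _): sum_gt0.
  by apply: eq_bigr => i _; rewrite mul_diag_mx ![in RHS]mxE mulrCA mulrC expr2.
split=> [x Dx|]; first by rewrite -Dw trmx_mul symD -mulmxA Dx mulmx0.
have cE : c = diag_mx d *m (P *m w).
  by rewrite -cj -Dw DE !mulmxA PP mul1mx.
have -> : \sum_i c i 0 ^+ 2 / d 0 i = (c^T *m (P *m w)) 0 0.
  rewrite mxE; apply: eq_bigr => i _; rewrite mxE cE mul_diag_mx mxE.
  have [->|di] := eqVneq (d 0 i) 0; first by rewrite !mul0r invr0 mulr0.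
  by field.
by rewrite -cj trmx_mul mulmxA -[_ *m P]mulmxA PTP mulmx1.
Qed.

End Type2.

(** * Indefinite distances and Gower matrices *)

Section Geometry.
Variable R : realType.

Lemma dissimilarity_sym n (D : 'M[R]_n) : dissimilarity D -> D^T = D.
Proof.
move=> [s [S [a [_ _ _ symS ->]]]]; apply/matrixP => u v; rewrite !mxE !summxE.
by apply: eq_bigr => i _; rewrite !mxE symS.
Qed.

Lemma dissimilarity_diag n (D : 'M[R]_n) v : dissimilarity D -> D v v = 0.
Proof.
move=> [s [S [a [S0 injS partS _ ->]]]]; rewrite summxE big1// => i _.
rewrite !mxE; have /and3P[_ /trivIsetP disjS _] := partS.
have /(disjS _ _ (imset_f _ _) (imset_f _ _)) : S (lift ord0 i) != S ord0.
  by rewrite (inj_eq injS) eq_sym neq_lift.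
move=> /(_ isT isT)/disjoint_setI0/setP/(_ (v, v)).
by rewrite !inE S0 inE eqxx andbT => ->; rewrite mulr0.
Qed.

Section Sphere.
Variables p q : nat.

Definition form_mx : 'M[R]_(p + q) := block_mx 1%:M 0 0 (- 1%:M).

Lemma bformE (x y : 'cV[R]_(p + q)) : bform x y = (x^T *m form_mx *m y) 0 0.
Proof.
rewrite -[x in RHS]vsubmxK -[y in RHS]vsubmxK tr_col_mx mul_row_block.
rewrite !mulmx0 addr0 add0r mulmx1 mulmxN mulmx1 mul_row_col mulNmx.
by rewrite /bform !mxE; congr (_ - _); apply: eq_bigr => i _; rewrite !mxE.
Qed.

Lemma form_mx_unit : form_mx \in unitmx.
Proof.
rewrite unitmxE det_ublock det1 mul1r -scaleN1r detZ det1 mulr1.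
by rewrite unitrX ?unitrN1.
Qed.

Lemma gramE n (X : 'M[R]_(p + q, n)) u v :
  bform (col u X) (col v X) = (X^T *m form_mx *m X) u v.
Proof.
by rewrite bformE tr_col -row_mul colE mulmxA -colE -row_mul !mxE.
Qed.

Lemma sphere_idist_mx n (X : 'M[R]_(p + q, n)) r :
  (forall v, col v X \in sphere r) ->
  idist_mx (fun v => col v X) =
  (2 * r) *: (allone R n *m (allone R n)^T) - 2 *: (X^T *m form_mx *m X).
Proof.
move=> Xr; have Gr v : (X^T *m form_mx *m X) v v = r.
  by rewrite -gramE; apply/eqP/Xr.
have bformC (x y : 'cV[R]_(p + q)) : bform x y = bform y x.
  by rewrite /bform; congr (_ - _); apply: eq_bigr => i _; rewrite mulrC.
have bformBr (x y z : 'cV[R]_(p + q)) : bform x (y - z) = bform x y - bform x z.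
  by rewrite !bformE mulmxBr !mxE.
apply/matrixP => u v; rewrite mxE /inorm bformBr ![bform (_ - _) _]bformC !bformBr.
rewrite [bform (col v X) (col u X)]bformC !gramE !Gr.
move: (X^T *m _ *m X) => G; rewrite !mxE big_ord1 !mxE; ring.
Qed.

Lemma row_free_congr n (Z : 'M[R]_(p + q, n)) : row_free Z ->
  \rank (Z^T *m form_mx *m Z) = (p + q)%N.
Proof.
move=> Zfree; rewrite mxrankMfree// mxrankMfree ?row_free_unit ?form_mx_unit//.
by rewrite mxrank_tr; apply/eqP.
Qed.

End Sphere.

Lemma center_allone n (l : 'cV[R]_n) : l^T *m allone R n = 1%:M ->
  (1%:M - allone R n *m l^T) *m allone R n = 0.
Proof. by move=> lj; rewrite mulmxBl mul1mx -mulmxA lj mulmx1 subrr. Qed.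

(** The projections I - j l^T all have kernel spanned by j, so composing two of
them only retains the outer one. Hence a factorization of one Gower matrix
yields factorizations of all the others. *)
Lemma gower_mx_recenter n (D : 'M[R]_n) l l' :
  l^T *m allone R n = 1%:M -> l'^T *m allone R n = 1%:M ->
  gower_mx D l' = (1%:M - allone R n *m l'^T) *m gower_mx D l
                  *m (1%:M - l' *m (allone R n)^T).
Proof.
move=> lj l'j; set j := allone R n.
have PP : (1%:M - j *m l'^T) *m (1%:M - j *m l^T) = 1%:M - j *m l'^T.
  by rewrite mulmxBr mulmx1 mulmxA center_allone// mul0mx subr0.
have PP' : (1%:M - l *m j^T) *m (1%:M - l' *m j^T) = 1%:M - l' *m j^T.
  have /(congr1 trmx) := PP.
  by rewrite trmx_mul !raddfB /= !trmx_mul !trmxK trmx1.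
by rewrite /gower_mx mulmxN mulNmx !mulmxA PP -[_ *m (1%:M - l *m _) *m _]mulmxA PP'.
Qed.

End Geometry.

Theorem theorem5p3 (R : realType) (n p q : nat) (D : 'M[R]_n)
    (dissD : dissimilarity D) (dimD : embedding_dim D p q) :
  (exists r : R, 0 < r /\
     exists x : 'I_n -> 'cV[R]_(p + q),
       (forall v, x v \in sphere r) /\ idist_mx x = D)
  <-> type2 D.
Proof.
have symD := dissimilarity_sym dissD.
case: dimD => l [lj sigF]; set j := allone R n in lj *.
(* For n = 0 the sum l^T j would be empty, hence 0 rather than 1. *)
have n0 : (0 < n)%N.
  case: n l D {dissD symD sigF} @j lj => // l _ j /matrixP/(_ 0 0)/eqP.
  by rewrite !mxE big_ord0 eq_sym oner_eq0.
have symF : (gower_mx D l)^T = gower_mx D l.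
  rewrite /gower_mx raddfN /= !trmx_mul ![(_ - _)^T]raddfB /= !trmx_mul.
  by rewrite !trmxK trmx1 symD mulmxA.
have [Z Zfree FE] := signature_factor symF sigF; rewrite -/(form_mx R p q) in FE.
have jl : j^T *m l = 1%:M by rewrite -[LHS]trmxK trmx_mul trmxK lj trmx1.
rewrite type2P//; split=> [[r [r0 [x [xr xD]]]]|[w [Dw jw]]].
  pose X : 'M[R]_(p + q, n) := \matrix_(i, v) x v i 0.
  have xE v : col v X = x v by apply/colP => i; rewrite !mxE.
  have DE : D = (2 * r) *: (j *m j^T) - 2 *: (X^T *m form_mx R p q *m X).
    rewrite -sphere_idist_mx => [|v]; last by rewrite xE.
    by rewrite -xD; apply/matrixP => u v; rewrite !mxE !xE.
  pose Y := X *m (1%:M - l *m j^T).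
  have FY : gower_mx D l = 2 *: (Y^T *m form_mx R p q) *m Y.
    have PD : (1%:M - j *m l^T) *m D
        = - (2 *: ((1%:M - j *m l^T) *m (X^T *m form_mx R p q *m X))).
      rewrite DE [LHS]mulmxBr -!scalemxAr mulmxA center_allone// mul0mx.
      by rewrite scaler0 sub0r.
    rewrite /gower_mx PD mulNmx opprK -!scalemxAl; congr (_ *: _).
    by rewrite /Y trmx_mul [(_ - _)^T]raddfB /= trmx1 trmx_mul trmxK !mulmxA.
  have /row_freeP[B YB] : row_free Y.
    rewrite /row_free eqn_leq rank_leq_row -{1}(row_free_congr Zfree) -FE FY.
    exact: mxrankM_maxr.
  (* B is a right inverse of Y = X (I - l j^T), so X maps j^perp onto the
     whole space; u is the vector of j^perp with the same image as l. *)
  pose u := (1%:M - l *m j^T) *m (B *m (X *m l)).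
  have Xu : X *m u = X *m l by rewrite mulmxA -/Y mulmxA YB mul1mx.
  have ju : j^T *m u = 0.
    by rewrite mulmxA mulmxBr mulmx1 [_ *m (l *m _)]mulmxA jl mul1mx subrr mul0mx.
  exists ((2 * r)^-1 *: (l - u)); split.
    have jlu : j^T *m (l - u) = 1%:M by rewrite mulmxBr jl ju subr0.
    have Xlu : X *m (l - u) = 0 by rewrite mulmxBr Xu subrr.
    rewrite DE -scalemxAr mulmxBl -!scalemxAl -!mulmxA jlu Xlu !mulmx0 scaler0.
    rewrite subr0 mulmx1 scalerA mulVf ?scale1r//.
    by rewrite mulf_neq0// ?gt_eqF// pnatr_eq0.
  rewrite -scalemxAr mulmxBr jl ju subr0 !mxE eqxx mulr1 invr_gt0.
  by rewrite mulr_gt0.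
set c := (_ *m w) 0 0 in jw; have c0 : c != 0 by rewrite gt_eqF.
have jwE : j^T *m w = c%:M by rewrite [LHS]mx11_scalar.
pose l' := c^-1 *: w.
have l'j : l'^T *m j = 1%:M.
  rewrite -[LHS]trmxK trmx_mul trmxK -scalemxAr jwE scale_scalar_mx mulVf//.
  by rewrite tr_scalar_mx.
have Dl' : D *m l' = c^-1 *: j by rewrite -scalemxAr Dw.
have F'E : gower_mx D l' = c^-1 *: (j *m j^T) - D.
  have l'D : l'^T *m D = c^-1 *: j^T.
    by rewrite -[LHS]trmxK trmx_mul trmxK symD Dl' linearZ.
  rewrite /gower_mx -mulmxA [D *m _]mulmxBr mulmx1 mulmxA Dl' -scalemxAl.
  rewrite mulmxBr -scalemxAr mulmxA center_allone// mul0mx scaler0 subr0.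
  by rewrite mulmxBl mul1mx -mulmxA l'D -scalemxAr opprB.
exists (2 * c)^-1; split; first by rewrite invr_gt0 mulr_gt0.
(* The norm of x_u - x_v is 2r minus twice the Gram entry, which is why the
   recentred factor is divided by the square root of 2. *)
pose X := (Num.sqrt 2)^-1 *: (Z *m (1%:M - l' *m j^T)).
have GE : X^T *m form_mx R p q *m X = 2^-1 *: gower_mx D l'.
  rewrite (gower_mx_recenter _ lj l'j) FE.
  have -> : 1%:M - allone R n *m l'^T = (1%:M - l' *m j^T)^T.
    by rewrite raddfB /= trmx1 trmx_mul trmxK.
  rewrite /X; move: (1%:M - l' *m _) => Q.
  rewrite [(_ *: _)^T]linearZ /= -!scalemxAl -scalemxAr scalerA -expr2 exprVn.
  by rewrite sqr_sqrtr ?ler0n// trmx_mul !mulmxA.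
have Xr v : col v X \in sphere (2 * c)^-1.
  apply/eqP; rewrite gramE GE F'E !mxE dissimilarity_diag// big_ord1 !mxE.
  by rewrite mulr1 mulr1 subr0 invfM.
exists (fun v => col v X); split=> //; rewrite (sphere_idist_mx Xr) GE F'E.
rewrite scalerA divff ?pnatr_eq0// scale1r opprB addrCA invfM mulrA divff ?pnatr_eq0//.
by rewrite mul1r subrr addr0.
Qed.
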